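(* Let $V$ be a complex inner product space of finite dimension $n\geq 2$ with a fixed orthonormal basis $\{f_1,\ldots,f_n\}$. Let $G=D_{2m}\le S_m$ ($m\geq 3$) be the dihedral group of degree $m$, and let $\psi=\psi_h$, where $h$ is an integer with $0<h<\frac{m}{2}$. Then $V^{\psi}(G)$ has an $O$-basis if and only if $m\equiv 0\pmod{4h_2}$, where $h_2$ is the $2$-part of $h$ (the largest power of $2$ dividing $h$).
   Context: $\times^m V$ is the Cartesian product of $m$ copies of $V$, with inner product $\langle (z_1,\ldots,z_m),(w_1,\ldots,w_m)\rangle=\sum_{i=1}^m\langle z_i,w_i\rangle$. For $1\le i\le n$, $1\le j\le m$, $f_{ij}\in\times^m V$ is the $m$-tuple whose $j$-th entry is $f_i$ and whose other entries are $0$. For $\tau\in G\le S_m$, $Q(\tau):\times^m V\to\times^m V$ is the linear operator $Q(\tau)(u_1,\ldots,u_m)=(u_{\tau^{-1}(1)},\ldots,u_{\tau^{-1}(m)})$. For a complex irreducible character $\lambda$ of $G$, the Cartesian symmetrizer is $C_\lambda=\frac{\lambda(1)}{|G|}\sum_{\tau\in G}\lambda(\tau)Q(\tau)$; the Cartesian symmetry class associated with $G$ and $\lambda$ is the range $V^\lambda(G)=C_\lambda(\times^m V)$; and the standard $\lambda$-symmetrized vectors are $f^\lambda_{ij}=C_\lambda(f_{ij})$ ($1\le i\le n$, $1\le j\le m$). A subspace $W$ of $V^\lambda(G)$ has an $O$-basis if it has a basis consisting of mutually orthogonal standard $\lambda$-symmetrized vectors. $D_{2m}$ is the subgroup of $S_m$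 ($m\ge 3$) generated by the $m$-cycle $r=(1\ 2\ \cdots\ m)$ and the permutation $s$ with $s(1)=1$ and $s(j)=m+2-j$ for $2\le j\le m$; $D_{2m}=\{r^k, sr^k : 0\le k<m\}$. For an integer $h$ with $0<h<m/2$, $\psi_h$ is the irreducible character of degree $2$ of $D_{2m}$ given by $\psi_h(r^k)=2\cos\frac{2kh\pi}{m}$, $\psi_h(sr^k)=0$ for $0\le k<m$. *)

(* Defs.v *)
From HB Require Import structures.
From mathcomp Require Import all_boot all_order all_fingroup all_algebra.
From mathcomp Require Import sesquilinear complex.
From mathcomp Require Import reals trigo.

Set Implicit Arguments.
Unset Strict Implicit.
Unset Printing Implicit Defensive.

Import Order.TTheory GRing.Theory Num.Theory.
Local Open Scope ring_scope.
Local Open Scope complex_scope.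

Section Dihedral.
Variable m : nat.

(* The points 1, ..., m are represented by 0, ..., m - 1 : 'I_m, so that the
   reflection 1 |-> 1, j |-> m + 2 - j becomes i |-> - i mod m. *)
Definition rot_perm : {perm 'I_m} := perm (@ordS_inj m).

Fact ord_opp_subproof (i : 'I_m) : ((m - i) %% m < m)%N.
Proof. by rewrite ltn_pmod //; apply: leq_ltn_trans (ltn_ord i). Qed.

Definition ord_opp (i : 'I_m) : 'I_m := Ordinal (ord_opp_subproof i).

Lemma ord_oppK : involutive ord_opp.
Proof.
case=> i lt_im; apply/val_inj => /=.
case: i lt_im => [|i] lt_im; first by rewrite subn0 modnn subn0 modnn.
have lt_mi : (m - i.+1 < m)%N by rewrite ltn_subrL /= (leq_ltn_trans _ lt_im).
by rewrite (modn_small lt_mi) subKn ?(ltnW lt_im) // modn_small.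
Qed.

Definition refl_perm : {perm 'I_m} := perm (inv_inj ord_oppK).

Definition dihedral : {group {perm 'I_m}} := <<[set rot_perm; refl_perm]>>%G.

Lemma rot_permX k (i : 'I_m) : ((rot_perm ^+ k)%g i = (i + k) %% m :> nat)%N.
Proof.
elim: k => [|k IHk]; first by rewrite expg0 perm1 addn0 modn_small.
by rewrite expgSr permM permE /= IHk addnS -addn1 modnDml addn1.
Qed.

Lemma rot_perm_inj : {in gtn m &, injective (fun k => rot_perm ^+ k)%g}.
Proof.
move=> k l lt_km lt_lm /= /permP eq_kl.
have m_gt0 : (0 < m)%N by apply: leq_ltn_trans lt_km.
have := congr1 val (eq_kl (Ordinal m_gt0)).
by rewrite /= !rot_permX !add0n !modn_small.
Qed.

Lemma rot_neq_refl k l :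
  (2 < m)%N -> (rot_perm ^+ k)%g <> (rot_perm ^+ l * refl_perm)%g.
Proof.
move=> m_gt2 /permP eq_kl.
have m_gt0 : (0 < m)%N by apply: leq_trans m_gt2.
have eqi (i : 'I_m) : (i + (k + l) = m - i %[mod m])%N.
  have /(congr1 val) := eq_kl i; rewrite permM permE /= rot_permX => e.
  have lt_am : ((i + l) %% m < m)%N by rewrite ltn_pmod.
  apply/eqP; rewrite addnA -modnDml e rot_permX modnDml -(eqn_modDr i).
  rewrite subnK ?(ltnW (ltn_ord i)) // -addnA (addnC l) -modnDmr.
  by rewrite subnK // ltnW.
have m_gt1 : (1 < m)%N by apply: ltnW.
have := eqi (Ordinal m_gt0); have := eqi (Ordinal m_gt1).
rewrite /= add0n subn0 modnn add1n -addn1 => e1 e0.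
move: e1; rewrite -modnDml e0 add0n !modn_small // ?subn1 ?prednK //.
by move=> e; move: m_gt2; rewrite -(prednK m_gt0) -e.
Qed.

End Dihedral.

(* refl_perm \o rot_perm ^ k as functions is (rot_perm ^+ k * refl_perm)%g:
   the group law of {perm T} composes from left to right. *)
Definition psi (R : realType) (m h : nat) (g : {perm 'I_m}) : R[i] :=
  if [pick k : 'I_m | g == (rot_perm m ^+ k)%g] is Some k
  then (2 * cos (2 * k%:R * h%:R * pi / m%:R))%:C else 0.

Lemma psi_rot (R : realType) (m h k : nat) : (k < m)%N ->
  psi R h (rot_perm m ^+ k)%g = (2 * cos (2 * k%:R * h%:R * pi / m%:R))%:C.
Proof.
move=> lt_km; rewrite /psi; case: pickP => [l /eqP eq_kl | /(_ (Ordinal lt_km))].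
  by rewrite (rot_perm_inj lt_km (ltn_ord l) eq_kl).
by rewrite /= eqxx.
Qed.

Lemma psi_refl (R : realType) (m h k : nat) : (2 < m)%N ->
  psi R h (rot_perm m ^+ k * refl_perm m)%g = 0.
Proof.
move=> m_gt2; rewrite /psi; case: pickP => [l /eqP eq_kl|//].
by case: (rot_neq_refl m_gt2 (esym eq_kl)).
Qed.

Section CartesianSymmetry.
Variables (R : realType) (V : vectType R[i]) (m : nat).
Local Notation C := R[i].
Local Notation Vm := {ffun 'I_m -> V}.

Section InnerProduct.
Variable dot : {dot V for Num.conj}.

Definition cart_dot (z w : Vm) : C := \sum_(i < m) dot (z i) (w i).

End InnerProduct.

Definition cart_perm (t : {perm 'I_m}) (u : Vm) : Vm :=
  [ffun i => u ((t^-1)%g i)].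

Fact cart_perm_is_linear t : linear (cart_perm t).
Proof. by move=> a u v; apply/ffunP => i; rewrite !ffunE. Qed.

HB.instance Definition _ t :=
  GRing.isLinear.Build C Vm Vm _ (cart_perm t) (cart_perm_is_linear t).

Definition cart_symmetrizer (G : {group {perm 'I_m}})
    (lam : {perm 'I_m} -> C) : 'End(Vm) :=
  (lam 1%g / #|G|%:R) *: \sum_(t in G) lam t *: linfun (cart_perm t).

Definition cart_symmetry_class G lam : {vspace Vm} :=
  limg (cart_symmetrizer G lam).

Definition cart_inj (v : V) (j : 'I_m) : Vm :=
  [ffun k => if k == j then v else 0].

Definition std_symmetrized n (f : n.-tuple V) G lam (i : 'I_n) (j : 'I_m) : Vm :=
  cart_symmetrizer G lam (cart_inj (tnth f i) j).

Definition has_O_basis (dot : {dot V for Num.conj}) n (f : n.-tuple V) G lam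
    (W : {vspace Vm}) : Prop :=
  exists X : seq Vm,
    [/\ basis_of W X,
        {in X, forall x, exists i j, x = std_symmetrized f G lam i j}
      & {in X &, forall x y, x != y -> cart_dot dot x y = 0}].

End CartesianSymmetry.

(* Main.v *)
Require Import Defs.
From HB Require Import structures.
From mathcomp Require Import all_boot all_order all_fingroup all_algebra.
From mathcomp Require Import sesquilinear complex.
From mathcomp Require Import reals trigo.
From mathcomp Require Import ring lra.

Set Implicit Arguments.
Unset Strict Implicit.
Unset Printing Implicit Defensive.

(* Put t = 2 pi h / m. Since psi vanishes on reflections, the a-th entry of
   f_ij^psi is a nonzero constant times cos((a - j) t) f_i, so the Gram matrix
   is <f_ij^psi, f_i'l^psi> = delta_ii' K cos((j - l) t) with K != 0.
   If cos((j - l) t) = 0 for some j, l, the 2n vectors f_ij^psi, f_il^psi are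
   orthogonal, and cos((a - b) t) expands along them. If no such j, l exist,
   an O-basis contains at most one vector f_ij^psi for each i, whereas
   f_ij^psi and f_i(j+1)^psi are independent because sin t != 0. Finally
   cos(d t) = 0 means 4 d h = m (2k + 1), which is solvable in d exactly when
   4 h_2 divides m. *)

Import Order.TTheory GRing.Theory Num.Theory.
Local Open Scope ring_scope.
Local Open Scope complex_scope.

(** * Trigonometric identities and the zeros of cosine *)

Section Trigonometry.
Variable R : realType.
Implicit Types x t : R.

Lemma sinD_mul2pi x k : sin (x + 2 * pi * k%:R) = sin x.
Proof. by rewrite -[RHS](periodicn (@sinD2pi R) k) mulr_natr mulr_natl. Qed.

Lemma cosD_mul2pi x k : cos (x + 2 * pi * k%:R) = cos x.
Proof. by rewrite -[RHS](periodicn (@cosD2pi R) k) mulr_natr mulr_natl. Qed.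

(* If [u - v] is an odd multiple of [pi / 2], then [cos (_ - u)] and
   [cos (_ - v)] are a cosine and a sine up to sign. *)
Lemma cosB_quadrature u v x y : cos (u - v) = 0 ->
  cos (x - y) = cos (x - u) * cos (y - u) + cos (x - v) * cos (y - v).
Proof.
move=> c0; have -> : x - y = (x - u) - (y - u) by ring.
have -> : x - v = (x - u) + (u - v) by ring.
have -> : y - v = (y - u) + (u - v) by ring.
move: (x - u) (y - u) (u - v) c0 => a b d c0.
have s1 : sin d ^+ 2 = 1 by rewrite sin2cos2 c0 expr0n subr0.
by rewrite cosB !cosD c0 -[sin a * sin b]mulr1 -s1; ring.
Qed.

(** The sum telescopes through [2 sin t cos y = sin (y + t) - sin (y - t)], since consecutive angles
    [y] differ by [2 t]. *)
Lemma sum_cos_arith t x m :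
  2 * sin t * (\sum_(a < m) cos (2 * a%:R * t + x))
  = sin ((2 * m%:R - 1) * t + x) - sin (x - t).
Proof.
elim: m => [|m IHm].
  rewrite big_ord0 mulr0; have -> : (2 * 0%:R - 1) * t + x = x - t by ring.
  by rewrite subrr.
rewrite big_ord_recr mulrDr {}IHm /= -[m.+1%:R]natr1.
have -> : (2 * (m%:R + 1) - 1) * t + x = 2 * m%:R * t + x + t by ring.
have -> : (2 * m%:R - 1) * t + x = 2 * m%:R * t + x - t by ring.
by rewrite !(sinB (_ + x)) !(sinD (_ + x)); ring.
Qed.

(** Removing the whole multiples of [pi] from [x] leaves a zero of cosine in [[0, pi)], where cosine
    is injective. *)
Lemma cos_eq0_odd x : 0 <= x -> cos x = 0 -> exists k, x = k.*2.+1%:R * pi / 2.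
Proof.
move=> x_ge0 cx0; pose k := Num.truncn (x / pi).
have pi0 := pi_gt0 R.
have /andP[] : k%:R <= x / pi < k.+1%:R.
  by apply: truncn_itv; rewrite divr_ge0 // ltW.
rewrite ler_pdivlMr // ltr_pdivrMr // -[k.+1%:R]natr1 mulrDl mul1r mulr_natl.
move=> le_kx lt_xk.
exists k; have cos_xk : cos (x - pi *+ k) = 0.
  move: cx0; rewrite -{1}[x](subrK (pi *+ k)) (alternatingn (@cosDpi R)).
  by move/eqP; rewrite mulf_eq0 signr_eq0 => /eqP.
have : x - pi *+ k = pi / 2.
  apply: cos_inj; rewrite ?cos_pihalf ?in_itv //=; apply/andP; split; lra.
move/(canRL (subrK _)) => ->.
by rewrite -mulr_natl -[k.*2.+1]addn1 natrD -muln2 natrM; field.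
Qed.

Lemma cos_odd_pihalf k : odd k -> cos (k%:R * (pi / 2)) = 0 :> R.
Proof.
move=> k_odd; rewrite -[k]odd_double_half k_odd natrD -muln2 natrM.
have -> : (1%:R + k./2%:R * 2%:R) * (pi / 2) = pi / 2 + pi *+ k./2 :> R.
  by rewrite -mulr_natl; field.
by rewrite (alternatingn (@cosDpi R)) cos_pihalf mulr0.
Qed.

End Trigonometry.

(** * The angle [t] and its arithmetic *)

Section RootAngle.
Variables (R : realType) (m h : nat).
Hypotheses (h_gt0 : (0 < h)%N) (h_lt : (2 * h < m)%N).

Definition root_angle : R := 2 * pi * h%:R / m%:R.
Local Notation t := root_angle.

Let m_gt0 : (0 < m)%N. Proof. exact: leq_ltn_trans h_lt. Qed.
Let mR_neq0 : m%:R != 0 :> R. Proof. by rewrite pnatr_eq0 -lt0n. Qed.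

Lemma mul_root_angle : m%:R * t = 2 * pi * h%:R.
Proof. by rewrite /t mulrC divfK. Qed.

(** The bound [2 * h < m] places [t] strictly between 0 and [pi]. *)
Lemma sin_root_angle_gt0 : 0 < sin t.
Proof.
apply: sin_gt0_pi; rewrite divr_gt0 ?mulr_gt0 ?pi_gt0 ?ltr0n //=.
rewrite ltr_pdivrMr ?ltr0n // -mulrA mulrCA ltr_pM2l ?pi_gt0 //.
by rewrite -natrM ltr_nat.
Qed.

(** Since [m t] is [h] full turns, indices of points matter only modulo [m]. *)
Lemma cos_root_modn k x : cos ((k %% m)%N%:R * t + x) = cos (k%:R * t + x).
Proof.
have turns : 2 * pi * (k %/ m * h)%N%:R = (k %/ m)%N%:R * (m%:R * t).
  by rewrite mul_root_angle natrM; ring.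
rewrite -[LHS](cosD_mul2pi _ (k %/ m * h)) turns.
by congr cos; rewrite [in RHS](divn_eq k m) natrD natrM; ring.
Qed.

(** Each product is half the sum of a constant cosine and one advancing by [2 t]. The latter cosines
    sum to zero: their total angle is [2 h] full turns, so the telescoped ends agree, and [sin t] is
    nonzero. *)
Lemma sum_cos_cos (x y : R) :
  \sum_(a < m) cos (a%:R * t - x) * cos (a%:R * t - y) = m%:R / 2 * cos (x - y).
Proof.
have cc (a : 'I_m) : cos (a%:R * t - x) * cos (a%:R * t - y)
    = (cos (2 * a%:R * t + (- x - y)) + cos (x - y)) / 2.
  have -> : 2 * a%:R * t + (- x - y) = (a%:R * t - x) + (a%:R * t - y) by ring.
  have -> : x - y = (a%:R * t - y) - (a%:R * t - x) by ring.
  by move: (_ - x) (_ - y) => u v; rewrite cosD cosB; field.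
rewrite (eq_bigr _ (fun a _ => cc a)) -mulr_suml big_split /= sumr_const card_ord.
have /eqP := sum_cos_arith t (- x - y) m.
have -> : (2 * m%:R - 1) * t + (- x - y) = - x - y - t + 2 * pi * (2 * h)%N%:R.
  by rewrite natrM (mulrCA (2 * pi)) -mul_root_angle; ring.
rewrite sinD_mul2pi subrr !mulf_eq0 pnatr_eq0 (gt_eqF sin_root_angle_gt0) /=.
by move/eqP->; rewrite add0r -mulr_natl; ring.
Qed.

Lemma cos_root_eq0P :
  (exists j l : 'I_m, cos (j%:R * t - l%:R * t) = 0) <-> (4 * h`_2 %| m)%N.
Proof.
split=> [[j [l]]|/dvdnP[q m_eq]].
  wlog le_lj : j l / (l <= j)%N => [IH|].
    case/orP: (leq_total l j) => [/IH//|/IH{}IH] c0; apply: IH.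
    by rewrite -cosN opprB.
  rewrite -mulrBl -natrB // => c0.
  have [|k] := cos_eq0_odd _ c0.
    by rewrite mulr_ge0 // divr_ge0 // !mulr_ge0 // pi_ge0.
  rewrite /t => e.
  have {e} : (4 * (h * (j - l)) = k.*2.+1 * m)%N.
    apply/eqP; rewrite -(eqr_nat R) !natrM; apply/eqP.
    have pi0 : pi != 0 :> R by rewrite gt_eqF ?pi_gt0.
    move: e pi0; move: (pi) (k.*2.+1%:R) => p v e p_neq0.
    have -> : v * m%:R = v * p / 2 * (2 * m%:R / p) by field.
    by rewrite -e; field; rewrite mR_neq0 p_neq0.
  (* [4 * h_2] is a power of 2, hence coprime to the odd factor, and it visibly divides the left
     side of [e]. *)
  move=> e; rewrite -(@Gauss_dvdr _ k.*2.+1) -?e.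
    by rewrite dvdn_pmul2l // dvdn_mulr // dvdn_part.
  rewrite coprimeMl (@coprimeXl 2 2) ?coprime2n //= ?odd_double //.
  by rewrite (pnat_coprime (pi := 2%N)) ?part_pnat //
    p'natE // dvdn2 /= odd_double.
have h2_gt0 : (0 < h`_2)%N by rewrite part_gt0.
have q_gt0 : (0 < q)%N by move: m_gt0; rewrite m_eq; case: (q).
have lt_qm : (q < m)%N by rewrite m_eq ltn_Pmulr // (leq_trans _ (leq_pmulr _ _)).
(* With [q = m / (4 h_2)], the angle [q t] is [pi / 2] times the odd part of [h]. *)
exists (Ordinal lt_qm), (Ordinal m_gt0); rewrite /= mul0r subr0 /t m_eq.
have h_odd : odd h`_2^'%N.
  have := part_pnat 2%N^' h; rewrite p'natE // dvdn2; exact: negbNE.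
have hE : h%:R = (h`_2)%N%:R * (h`_2^')%N%:R :> R by rewrite -natrM partnC.
rewrite hE !natrM.
rewrite -[RHS](cos_odd_pihalf R h_odd); congr cos; move: (pi) => p; field.
by rewrite !pnatr_eq0 -!lt0n q_gt0 h2_gt0.
Qed.

End RootAngle.

(** * The inner product on the Cartesian power *)

Section CartesianDot.
Variables (R : realType) (V : vectType R[i]) (m : nat).
Variable dot : {dot V for Num.conj}.
Local Notation C := R[i].
Local Notation Vm := {ffun 'I_m -> V}.

Fact cart_dot_bilinear :
  bilinear_for ( *%R : GRing.Scale.law C C)
    (Num.conj \; *%R : GRing.Scale.law C C) (@cart_dot R V m dot).
Proof.
split=> u a v w /=; rewrite /cart_dot mulr_sumr -big_split /=;
  apply: eq_bigr => i _; rewrite !ffunE.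
  by rewrite linearDl linearZl_LR.
by rewrite linearDr linearZr_LR.
Qed.

HB.instance Definition _ :=
  bilinear_isBilinear.Build C Vm Vm C ( *%R) (Num.conj \; *%R)
    (@cart_dot R V m dot) cart_dot_bilinear.

Fact cart_dot_hermitian (u v : Vm) :
  cart_dot dot u v = (-1) ^+ false * Num.conj (cart_dot dot v u).
Proof.
rewrite expr0 mul1r /cart_dot rmorph_sum /=; apply: eq_bigr => i _.
by rewrite hermC mul1r.
Qed.

HB.instance Definition _ :=
  isHermitianSesquilinear.Build C Vm false Num.conj (@cart_dot R V m dot)
    cart_dot_hermitian.

Fact cart_dot_gt0 (u : Vm) : u != 0 -> 0 < cart_dot dot u u.
Proof.
move=> u_neq0; rewrite lt_def sumr_ge0 => [|i _]; last exact: dnorm_ge0.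
rewrite andbT; apply: contraNneq u_neq0 => /eqP.
rewrite psumr_eq0 => [/allP u0|i _]; last exact: dnorm_ge0.
apply/eqP/ffunP=> i; rewrite ffunE; apply/eqP; rewrite -(dnorm_eq0 dot).
exact: u0 (mem_index_enum i).
Qed.

HB.instance Definition _ :=
  isDotProduct.Build C Vm (@cart_dot R V m dot) cart_dot_gt0.

End CartesianDot.

Section OrthogonalBasis.
Variables (C : numClosedFieldType) (U : vectType C) (dot : {dot U for Num.conj}).

(** Expanding the second argument of [dot w w] over [X] shows that it vanishes. *)
Lemma orthogonal_span_eq0 (X : seq U) w :
  w \in <<X>>%VS -> {in X, forall x, dot w x = 0} -> w = 0.
Proof.
move=> wX oX; apply/eqP; rewrite -(dnorm_eq0 dot); apply/eqP.
rewrite {2}(coord_span (X := in_tuple X) wX) linear_sumr big1 // => i _.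
by rewrite linearZ /= oX ?mulr0 ?mem_nth.
Qed.

End OrthogonalBasis.

(** * The standard symmetrized vectors: entries, Gram matrix, span *)

Section StandardVectors.
Variables (R : realType) (V : vectType R[i]) (dot : {dot V for Num.conj}).
Variables (n : nat) (f : n.-tuple V).
Hypotheses (f_basis : basis_of fullv f) (f_on : orthonormal dot f).
Variables (m h : nat).
Hypotheses (m_gt2 : (2 < m)%N) (h_gt0 : (0 < h)%N) (h_lt : (2 * h < m)%N).

Local Notation t := (root_angle R m h).
Local Notation W := (cart_symmetry_class V (dihedral m) (psi R h)).
Local Notation s := (std_symmetrized f (dihedral m) (psi R h)).
Local Notation c0 := (@psi R m h 1%g / #|dihedral m|%:R : R[i]).

Let m_gt0 : (0 < m)%N. Proof. exact: leq_trans m_gt2. Qed.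

Lemma symmetrizer_scale_neq0 : c0 != 0.
Proof.
rewrite mulf_neq0 ?invr_eq0 ?pnatr_eq0 -?lt0n ?cardG_gt0 //.
rewrite -[1%g](expg0 (rot_perm m)) psi_rot // mulr0 !mul0r cos0 mulr1.
by rewrite eq_complex /= pnatr_eq0.
Qed.

Lemma psi_neq0 (g : {perm 'I_m}) :
  psi R h g != 0 -> exists k : 'I_m, g = (rot_perm m ^+ k)%g.
Proof. by rewrite /psi; case: pickP => [k /eqP-> _|]; [exists k | rewrite eqxx]. Qed.

(** In the sum over the group, only the unique rotation carrying [j] to [a] contributes. *)
Lemma std_symmetrizedE i j a :
  s i j a = (c0 * (2 * cos (a%:R * t - j%:R * t))%:C) *: tnth f i.
Proof.
rewrite /std_symmetrized /cart_symmetrizer scale_lfunE sum_lfunE ffunE sum_ffunE.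
(* The exponent is [a - j] modulo [m]; the added [m] avoids truncated subtraction and later costs
   [h] full turns. *)
have lt_k : ((a + (m - j)) %% m < m)%N by rewrite ltn_pmod.
set k := ((a + (m - j)) %% m)%N in lt_k.
have rot_ja : (rot_perm m ^+ k)%g j = a.
  apply/val_inj; rewrite /= rot_permX modnDmr addnCA subnKC ?(ltnW (ltn_ord j)) //.
  by rewrite modnDr modn_small.
have inv_rot : ((rot_perm m ^+ k)^-1)%g a = j by rewrite -rot_ja permK.
rewrite (bigD1 (rot_perm m ^+ k)%g) ?groupX ?mem_gen ?inE ?eqxx //= big1 ?addr0.
  rewrite scale_lfunE lfunE /= !ffunE inv_rot eqxx scalerA psi_rot //.
  congr (_ * (2 * _)%:C *: _).
  have -> : 2 * k%:R * h%:R * pi / m%:R = k%:R * t + 0 by rewrite /root_angle; ring.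
  rewrite /k cos_root_modn // natrD natrB ?(ltnW (ltn_ord j)) //.
  rewrite -[RHS](cosD_mul2pi _ h).
  by rewrite -(mul_root_angle R h_lt); congr cos; ring.
move=> g /andP[_ g_neq]; rewrite scale_lfunE lfunE /= !ffunE.
case: eqP => [ga|_]; last by rewrite scaler0.
have [->|/psi_neq0[l gE]] := eqVneq (psi R h g) 0; first by rewrite scale0r.
case/eqP: g_neq; rewrite gE; congr (_ ^+ _)%g; apply/eqP.
rewrite -(modn_small (ltn_ord l)) -(modn_small lt_k) -(eqn_modDl j).
by rewrite -!rot_permX rot_ja -ga gE permKV.
Qed.

Lemma gram_std_symmetrized : exists2 K : R[i], K != 0 &
  forall i j i' l, cart_dot dot (s i j) (s i' l)
    = (i == i')%:R * (K * (cos (j%:R * t - l%:R * t))%:C).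
Proof.
have /orthonormalP[uniq_f dot_f] := f_on.
(* The factor [2 m] is 4, from the two entries, times the [m / 2] of [sum_cos_cos]. *)
exists (c0 * Num.conj c0 * (2 * m%:R)%:C) => [|i j i' l].
  rewrite mulf_neq0 //.
    by rewrite mulf_neq0 ?conjC_eq0 ?symmetrizer_scale_neq0.
 by rewrite (fmorph_eq0 (real_complex R)) mulf_neq0 ?pnatr_eq0 // -lt0n.
have -> : (i == i')%:R = dot (tnth f i) (tnth f i').
  by rewrite dot_f ?mem_tnth // (inj_eq (tuple_uniqP _ uniq_f)).
rewrite /cart_dot; under eq_bigr => a _.
  have -> : dot (s i j a) (s i' l a) =
     dot (tnth f i) (tnth f i') * (c0 * Num.conj c0) *
     (4 * (cos (a%:R * t - j%:R * t) * cos (a%:R * t - l%:R * t)))%:C.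
    rewrite !std_symmetrizedE linearZl_LR linearZr_LR /= (rmorphM Num.conj) /=.
    rewrite (conjc_real _ : Num.conj _%:C = _).
    by move: c0 => c; rewrite !rmorphM /=; ring.
  over.
rewrite -mulr_sumr -rmorph_sum -mulr_sumr sum_cos_cos // -!mulrA.
congr (_ * (_ * (_ * _))).
by rewrite -(rmorphM (real_complex R)); congr (_ * real_complex R _); field.
Qed.

(** Splitting a tuple into its entries, and each entry into coordinates along [f], reduces the range
    of the symmetrizer to the standard vectors. *)
Lemma cart_symmetry_class_le (U : {vspace {ffun 'I_m -> V}}) :
  (forall i j, s i j \in U) -> (W <= U)%VS.
Proof.
move=> sU; apply/subvP => _ /memv_imgP[u _ ->].
have -> : u = \sum_(j < m) cart_inj (u j) j.
  apply/ffunP=> a; rewrite sum_ffunE (bigD1 a) //= ffunE eqxx big1 ?addr0 // => j.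
  by rewrite ffunE eq_sym => /negPf->.
rewrite linear_sum memv_suml // => j _.
have -> : cart_inj (u j) j
    = \sum_(i < n) coord f i (u j) *: cart_inj (tnth f i) j.
  apply/ffunP=> a; rewrite sum_ffunE ffunE.
  case: eqP => [->|/eqP/negPf aj].
    rewrite {1}(coord_basis f_basis (memvf (u j))); apply: eq_bigr => i _.
    by rewrite !ffunE eqxx (tnth_nth 0).
  by rewrite big1 // => i _; rewrite !ffunE aj scaler0.
by rewrite linear_sum memv_suml // => i _; rewrite linearZ memvZ // sU.
Qed.

Lemma std_symmetrized_mem i j : s i j \in W.
Proof. exact: memv_img (memvf _). Qed.

Lemma O_basis_iff_cos_eq0 : (0 < n)%N ->
  has_O_basis dot f (dihedral m) (psi R h) W
  <-> exists j l : 'I_m, cos (j%:R * t - l%:R * t) = 0.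
Proof.
move=> n_gt0; have [K K_neq0 gram] := gram_std_symmetrized.
have cos_ii (j : 'I_m) : cos (j%:R * t - j%:R * t) = 1 by rewrite subrr cos0.
split=> [[X [X_basis X_std X_orth]]|[j0 [l0 cos_jl]]].
  suff /existsP[j /existsP[l /eqP]] :
      [exists j : 'I_m, exists l : 'I_m, cos (j%:R * t - l%:R * t) == 0].
    by exists j, l.
  apply: contraT => /existsPn cos_neq0.
  have {}cos_neq0 (j l : 'I_m) : cos (j%:R * t - l%:R * t) != 0.
    by have /existsPn := cos_neq0 j; apply.
  have X_eq0 w : w \in W -> {in X, forall x, cart_dot dot w x = 0} -> w = 0.
    by rewrite -(span_basis X_basis); apply: orthogonal_span_eq0.
  pose i0 := Ordinal n_gt0.
  (* [X] must contain a vector of index [i0]: otherwise any [s i0 j] would be orthogonal to [X],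
     hence zero, although its square norm is [K]. *)
  have [/hasP[x0 x0X /existsP[j0 /eqP x0E]]|] :=
      boolP (has (fun x => [exists j, x == s i0 j]) X); last first.
    move/hasPn=> noX; pose j0 := Ordinal m_gt0.
    suff /X_eq0 s0 : {in X, forall x, cart_dot dot (s i0 j0) x = 0}.
      have /eqP := gram i0 j0 i0 j0; rewrite {1}s0 ?std_symmetrized_mem //.
      by rewrite eqxx linear0l cos_ii mul1r mulr1 eq_sym (negPf K_neq0).
    move=> x xX; have [i [j xE]] := X_std x xX; rewrite xE gram.
    case: eqP => [i0E|]; last by rewrite mul0r.
    by have /existsP[] := noX x xX; exists j; rewrite xE i0E.
  subst x0; pose j1 := ordS j0.
  (* [w] is the part of [s i0 j1] orthogonal to [s i0 j0]; the wrap-around in [ordS] is absorbed by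
     [cos_root_modn]. *)
  pose w := s i0 j1 - (cos t)%:C *: s i0 j0.
  have cos_j1 x : cos (j1%:R * t + x) = cos (j0%:R * t + t + x).
    by rewrite /j1 /= cos_root_modn // -natr1 mulrDl mul1r.
  have cos_j10 : cos (j1%:R * t - j0%:R * t) = cos t.
    by rewrite cos_j1 addrAC subrr add0r.
  have cos_j01 : cos (j0%:R * t - j1%:R * t) = cos t by rewrite -cosN opprB.
  have w_dot i j : cart_dot dot w (s i j) = (i0 == i)%:R *
      (K * (cos (j1%:R * t - j%:R * t) - cos t * cos (j0%:R * t - j%:R * t))%:C).
    by rewrite linearBl linearZl_LR /= !gram rmorphB rmorphM /=; ring.
  have w0 : w = 0.
    apply: X_eq0 => [|x xX].
      by rewrite memvB ?memvZ ?std_symmetrized_mem.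
    have [i [j xE]] := X_std x xX.
    have [i0E|] := eqVneq i0 i; last first.
      by rewrite xE w_dot => /negPf->; rewrite mul0r.
    (* A second element of [X] with index [i0] would be orthogonal to [s i0 j0], against
       [cos_neq0]. *)
    have [->|/X_orth] := eqVneq x (s i0 j0).
      by rewrite w_dot cos_j10 cos_ii mulr1 subrr !mulr0.
    move=> /(_ xX x0X)/eqP; rewrite xE gram -i0E eqxx mul1r mulf_eq0.
    by rewrite (negPf K_neq0) (fmorph_eq0 (real_complex R)) (negPf (cos_neq0 _ _)).
  (* The product of [w] with [s i0 j1] is [K (1 - cos t ^ 2) = K sin t ^ 2], which is nonzero. *)
  have /eqP := w_dot i0 j1.
  rewrite {1}w0 linear0l eqxx mul1r cos_ii cos_j01 eq_sym mulf_eq0 (negPf K_neq0).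
  rewrite (fmorph_eq0 (real_complex R)) /= -expr2 -sin2cos2 sqrf_eq0.
  by rewrite gt_eqF // sin_root_angle_gt0.
pose X := [seq s p.1 (if p.2 then j0 else l0) | p : 'I_n * bool].
have cos_lj : cos (l0%:R * t - j0%:R * t) = 0 by rewrite -cosN opprB.
have X_gram (p q : 'I_n * bool) :
    cart_dot dot (s p.1 (if p.2 then j0 else l0)) (s q.1 (if q.2 then j0 else l0))
    = (p == q)%:R * K.
  case: p q => [i b] [i' b'] /=; rewrite gram -pair_eqE /pair_eq /=.
  case: eqP => [_|_]; last by rewrite !mul0r.
  by case: b b' => [] [] /=; rewrite ?cos_ii ?cos_jl ?cos_lj ?mulr0 ?mulr1 ?mul0r.
have X_orth : pairwise_orthogonal (@cart_dot R V m dot) X.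
  (* By [X_gram] the Gram matrix is [K] times the identity, so equal vectors come from equal index
     pairs. *)
  have X_inj : injective (fun p : 'I_n * bool => s p.1 (if p.2 then j0 else l0)).
    move=> p q /= pq; have /eqP := X_gram p q; rewrite -pq X_gram eqxx mul1r.
    by case: (p =P q) => // _; rewrite mul0r (negPf K_neq0).
  apply/pairwise_orthogonalP; split=> [/=|_ _ /imageP[p _ ->] /imageP[q _ ->]].
    rewrite map_inj_uniq ?enum_uniq // andbT.
    apply/imageP => -[p _ p0]; have /eqP := X_gram p p.
    by rewrite -p0 linear0l eqxx mul1r eq_sym (negPf K_neq0).
  rewrite (inj_eq X_inj) => /negPf pq.
  by apply: etrans (X_gram p q) _; rewrite pq mul0r.
exists X; split=> [|_ /imageP[[i b] _ ->]|]; last 1 first.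
- by have /pairwise_orthogonalP[] := X_orth.
- have XE p : s p.1 (if p.2 then j0 else l0) \in <<X>>%VS.
    by apply/memv_span/image_f.
  rewrite /basis_of (orthogonal_free X_orth) andbT eqEsubv; apply/andP; split.
    by apply/span_subvP => _ /imageP[p _ ->]; apply: std_symmetrized_mem.
  apply: cart_symmetry_class_le => i j.
  (* Entrywise this is [cosB_quadrature] at the angles [a t] and [j t]. *)
  have -> : s i j = (cos (j%:R * t - j0%:R * t))%:C *: s i j0
                  + (cos (j%:R * t - l0%:R * t))%:C *: s i l0.
    apply/ffunP => a; rewrite !ffunE !std_symmetrizedE !scalerA -scalerDl.
    rewrite (cosB_quadrature (a%:R * t) (j%:R * t) cos_jl) !(mulrCA _ c0) -mulrDr.
    rewrite -!(rmorphM (real_complex R)) -(rmorphD (real_complex R)).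
    by congr ((_ * real_complex R _) *: _); ring.
  by rewrite memvD // memvZ //; [exact: (XE (i, true)) | exact: (XE (i, false))].
- by exists i, (if b then j0 else l0).
Qed.

End StandardVectors.

Theorem theorem4p2 (R : realType) (V : vectType R[i])
    (dot : {dot V for Num.conj})
    (n : nat) (n_ge2 : (2 <= n)%N)
    (f : n.-tuple V) (f_basis : basis_of fullv f) (f_on : orthonormal dot f)
    (m : nat) (m_ge3 : (3 <= m)%N)
    (h : nat) (h_gt0 : (0 < h)%N) (h_lt : (2 * h < m)%N) :
  has_O_basis dot f (dihedral m) (psi R h)
    (cart_symmetry_class V (dihedral m) (psi R h))
  <-> (m = 0 %[mod 4 * h`_2])%N.
Proof.
rewrite O_basis_iff_cos_eq0 // ?(ltnW n_ge2) // cos_root_eq0P // mod0n.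
by split=> /eqP.
Qed.
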